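(* Let $K$ be a field, let $h\ge 2$ be an integer and let $I\subset K[x,y,z,t]$ be the kernel of the $K$-algebra homomorphism $K[x,y,z,t]\to K[s]$ to a polynomial ring in one variable $s$ given by $$x\mapsto s^{(2h-1)2h},\quad y\mapsto s^{(2h-1)(2h+1)},\quad z\mapsto s^{2h(2h+1)},\quad t\mapsto s^{2h(2h+1)+2h-1}.$$ Then the set of $4h$ elements $$\{z^{i-1}t^{2h-i}-y^{2h-i}x^{i+1} : 1\le i\le 2h\}\cup\{xt-yz\}\cup\{x^{2h+1-j}z^j-y^{2h-j}t^j : 0\le j\le 2h-2\}$$ is a minimal generating set and a minimal standard basis of $I$.
   Context: For a nonzero polynomial $f$, $f^*$ is its nonzero homogeneous component of least degree (standard grading on $K[x,y,z,t]$). For an ideal $I$, $I^*=(f^*: f\in I, f\ne 0)$. A set $f_1,\dots,f_m\in I$ is a standard basis of $I$ if $I^*=(f_1^*,\dots,f_m^* )$; it is a minimal standard basis if moreover $f_1^*,\dots,f_m^*$ is a minimal generating set of $I^*$. *)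

(* Defs.v *)
From mathcomp Require Import all_boot all_order all_algebra.
From mathcomp Require Export mpoly.
Set Implicit Arguments.
Unset Strict Implicit.
Unset Printing Implicit Defensive.
Import GRing.Theory.
Local Open Scope ring_scope.

(* Ideals are Prop-valued predicates, compared extensionally. *)
Definition same_ideal (R : Type) (J1 J2 : R -> Prop) : Prop :=
  forall f, J1 f <-> J2 f.

Definition ideal_gen (R : comNzRingType) (S : R -> Prop) : R -> Prop :=
  fun f => exists s : seq (R * R),
    (forall u, u \in s -> S u.2) /\ f = \sum_(u <- s) u.1 * u.2.

Definition generates (R : comNzRingType) (J : R -> Prop) (s : seq R) : Prop :=
  same_ideal J (ideal_gen (fun f => f \in s)).

(* Irredundancy: no proper subfamily of s still generates J. In particular
   such an s has no repeated entries. *)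
Definition minimal_generating_set (R : comNzRingType) (J : R -> Prop)
    (s : seq R) : Prop :=
  generates J s /\ (forall s', subseq s' s -> generates J s' -> s' = s).

Section InitialForms.
Variables (n : nat) (K : fieldType).
Implicit Types (f : {mpoly K[n]}) (I : {mpoly K[n]} -> Prop).

(* The least degree of a monomial of f. Every such degree is < msize f, so the
   default value of the minimum only matters for f = 0. *)
Definition mord f : nat := \big[minn/msize f]_(m <- msupp f) mdeg m.

Definition initial_form f : {mpoly K[n]} := pihomog mdeg (mord f) f.

Definition initial_ideal I : {mpoly K[n]} -> Prop :=
  ideal_gen (fun g => exists f, [/\ I f, f != 0 & g = initial_form f]).

Definition standard_basis I (s : seq {mpoly K[n]}) : Prop :=
  (forall f, f \in s -> I f /\ f != 0) /\
  generates (initial_ideal I) (map initial_form s).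

Definition minimal_standard_basis I (s : seq {mpoly K[n]}) : Prop :=
  standard_basis I s /\
  minimal_generating_set (initial_ideal I) (map initial_form s).

End InitialForms.

Section MonomialCurve.
Variables (K : fieldType) (h : nat).

Definition varx : {mpoly K[4]} := 'X_(@Ordinal 4 0 isT).
Definition vary : {mpoly K[4]} := 'X_(@Ordinal 4 1 isT).
Definition varz : {mpoly K[4]} := 'X_(@Ordinal 4 2 isT).
Definition vart : {mpoly K[4]} := 'X_(@Ordinal 4 3 isT).

Definition curve_exponents : 4.-tuple nat :=
  [tuple ((2 * h - 1) * (2 * h))%N;
         ((2 * h - 1) * (2 * h + 1))%N;
         (2 * h * (2 * h + 1))%N;
         (2 * h * (2 * h + 1) + 2 * h - 1)%N].

Definition curve_map : {mpoly K[4]} -> {poly K} :=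
  mmap polyC (fun i => 'X^(tnth curve_exponents i)).

Definition curve_ideal : {mpoly K[4]} -> Prop := fun f => curve_map f = 0.

Definition curve_generators : seq {mpoly K[4]} :=
  [seq varz ^+ (i - 1) * vart ^+ (2 * h - i)
       - vary ^+ (2 * h - i) * varx ^+ (i + 1) | i <- index_iota 1 (2 * h).+1]
  ++ [:: varx * vart - vary * varz]
  ++ [seq varx ^+ (2 * h + 1 - j) * varz ^+ j
          - vary ^+ (2 * h - j) * vart ^+ j | j <- index_iota 0 (2 * h - 2).+1].

End MonomialCurve.

(* Main.v *)
(* Write n = 2h and give a monomial the weight equal to the exponent of its image
   in K[s]. The generators are binomials of equal weight, and each yields a rewriting
   rule: yz -> xt, and otherwise the monomial of lower degree -> the one of higher
   degree. Every rule preserves the weight, does not lower the degree and raises the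
   exponent of x, so rewriting ends at a standard monomial. By the Chinese remainder
   theorem modulo n and n - 1, coprime to each other and with 2 invertible modulo
   n - 1, a standard monomial is determined by its weight. Hence the normal form of an
   element of I vanishes, which gives generation; and the monomials of f in I whose
   normal form has degree ord f all have degree ord f, so the same cancellation takes
   place in f^* modulo the initial forms. Minimality holds because each generator has a
   lowest-degree monomial that no monomial of another generator divides. *)
Require Import Defs.
From mathcomp Require Import all_boot all_order all_algebra.
From mathcomp Require Import zify ring.
Set Implicit Arguments.
Unset Strict Implicit.
Unset Printing Implicit Defensive.
Import GRing.Theory.
Local Open Scope ring_scope.

(** * Closure properties of generated ideals *)

Section IdealGen.
Variable R : comNzRingType.
Implicit Types (S : R -> Prop) (f g : R) (s : seq R).

Lemma ideal_gen0 S : ideal_gen S 0.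
Proof. by exists [::]; rewrite big_nil. Qed.

Lemma ideal_genD S f g : ideal_gen S f -> ideal_gen S g -> ideal_gen S (f + g).
Proof.
move=> [s [Ss ->]] [t [St ->]]; exists (s ++ t); rewrite big_cat; split=> // u.
by rewrite mem_cat => /orP[/Ss|/St].
Qed.

Lemma ideal_genMl S a f : ideal_gen S f -> ideal_gen S (a * f).
Proof.
move=> [s [Ss ->]]; exists [seq (a * u.1, u.2) | u <- s]; split.
  by move=> _ /mapP[u us ->] /=; exact: Ss.
by rewrite big_map mulr_sumr; apply: eq_bigr => u _; rewrite /= mulrA.
Qed.

Lemma ideal_genMr S a f : ideal_gen S f -> ideal_gen S (f * a).
Proof. by rewrite mulrC; apply: ideal_genMl. Qed.

Lemma ideal_genN S f : ideal_gen S f -> ideal_gen S (- f).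
Proof. by rewrite -mulN1r; apply: ideal_genMl. Qed.

Lemma mem_ideal_gen S f : S f -> ideal_gen S f.
Proof.
move=> Sf; exists [:: (1, f)]; rewrite big_seq1 mul1r; split=> // u.
by rewrite inE => /eqP->.
Qed.

Lemma ideal_gen_sum S (T : eqType) (r : seq T) (F : T -> R) :
  (forall i, i \in r -> ideal_gen S (F i)) -> ideal_gen S (\sum_(i <- r) F i).
Proof.
move=> SF; rewrite big_seq; apply: (big_ind (ideal_gen S)) => //.
  exact: ideal_gen0.
exact: ideal_genD.
Qed.

Lemma ideal_gen_min S S' f :
  (forall g, S g -> ideal_gen S' g) -> ideal_gen S f -> ideal_gen S' f.
Proof.
move=> SS' [s [Ss ->]]; apply: ideal_gen_sum => u us.
by apply/ideal_genMl/SS'/Ss.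
Qed.

Lemma ideal_gen_cancel S f g : ideal_gen S (f - g) -> ideal_gen S g ->
  ideal_gen S f.
Proof. by move=> Sfg Sg; rewrite -(subrK g f); apply: ideal_genD. Qed.

End IdealGen.

(** * Irredundancy of a family by means of witness monomials *)

Section Witnesses.
Variables (n : nat) (K : fieldType) (T : eqType) (r : seq T).
Variables (g : T -> {mpoly K[n]}) (M : T -> 'X_{1..n}).
Hypothesis r_uniq : uniq r.
Hypothesis M_supp : forall i, i \in r -> M i \in msupp (g i).
Hypothesis M_ndvd : forall i k m, i \in r -> k \in r -> i != k ->
  m \in msupp (g k) -> ~~ (m <= M i)%MM.

(** Every monomial of a product is a multiple of some monomial of [q]. *)
Lemma mcoeffM_ndvd (p q : {mpoly K[n]}) (m0 : 'X_{1..n}) :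
  (forall m, m \in msupp q -> ~~ (m <= m0)%MM) -> (p * q)@_m0 = 0.
Proof.
move=> ndvd; apply/eqP; rewrite mcoeff_eq0; apply/negP.
move=> /msuppM_le /allpairsP[[m1 m2] /= [_ /ndvd /negP nle m0E]].
by apply: nle; rewrite m0E; apply/mnm_lepP => i; rewrite mnmDE leq_addl.
Qed.

Lemma witness_inj : {in r &, injective g}.
Proof.
move=> i k ri rk gik; apply/eqP/negPn/negP => /(M_ndvd ri rk).
by move/(_ (M i)); rewrite -gik => /(_ (M_supp ri)); rewrite lepm_refl.
Qed.

Lemma witness_uniq : uniq (map g r).
Proof. by rewrite map_inj_in_uniq //; exact: witness_inj. Qed.

(** If [g i] were missing from [s'], it would be a combination of other [g k], whose monomials do
    not divide [M i]; the coefficient of [M i] in [g i] would then vanish. *)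
Lemma witness_minimal J : generates J (map g r) ->
  minimal_generating_set J (map g r).
Proof.
move=> Jr; split=> // s' sub_s' Js'; apply/eqP.
have [_ <-] := size_subseq_leqif sub_s'.
rewrite eqn_leq size_subseq //=; apply: uniq_leq_size witness_uniq _.
move=> _ /mapP[i ri ->]; apply/negPn/negP => gi_s'.
have: ideal_gen (fun f => f \in s') (g i).
  by apply/Js'/Jr; apply: mem_ideal_gen; exact: map_f.
case=> t [tP giE].
have := M_supp ri; rewrite mcoeff_msupp giE linear_sum big_seq big1 ?eqxx //=.
move=> u /tP us'; have /mapP[k rk u2E] := mem_subseq sub_s' us'.
apply: mcoeffM_ndvd => m; rewrite u2E; apply: M_ndvd => //.
by apply: contra gi_s' => /eqP->; rewrite -u2E.
Qed.

End Witnesses.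

(** * Order and initial form of a difference of two monomials *)

Section InitialFormFacts.
Variables (n : nat) (K : fieldType).
Implicit Types (f : {mpoly K[n]}) (m p q : 'X_{1..n}).

Lemma mord_le f m : m \in msupp f -> (mord f <= mdeg m)%N.
Proof.
rewrite /mord; elim: (msupp f) => // p s IH; rewrite inE big_cons.
case/orP => [/eqP->|/IH le_m]; first exact: geq_minl.
by rewrite geq_min le_m orbT.
Qed.

Lemma mord_eq f m : m \in msupp f ->
  (forall p, p \in msupp f -> (mdeg m <= mdeg p)%N) -> mord f = mdeg m.
Proof.
move=> fm min_m; apply/eqP; rewrite eqn_leq mord_le //=.
rewrite /mord big_seq; apply: (big_ind (fun d => mdeg m <= d)%N) => //.
  exact/ltnW/msize_mdeg_lt.
by move=> a b ma mb; rewrite leq_min ma.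
Qed.

Definition monomial_diff (u : 'X_{1..n} * 'X_{1..n}) : {mpoly K[n]} :=
  'X_[u.1] - 'X_[u.2].

Lemma mem_msupp_monomial_diff (u : 'X_{1..n} * 'X_{1..n}) m : u.1 != u.2 ->
  (m \in msupp (monomial_diff u)) = (m == u.1) || (m == u.2).
Proof.
move=> u12; rewrite mcoeff_msupp mcoeffB !mcoeffX (eq_sym m) (eq_sym m).
have [<-|_] := eqVneq u.1 m; first by rewrite (eq_sym u.2) (negPf u12) subr0 oner_eq0.
by case: (u.2 == m); rewrite /= ?mulr0n ?sub0r ?oppr_eq0 ?oner_eq0 ?eqxx.
Qed.

Lemma mord_monomial_diff (u : 'X_{1..n} * 'X_{1..n}) : u.1 != u.2 ->
  mord (monomial_diff u) = minn (mdeg u.1) (mdeg u.2).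
Proof.
move=> u12; case: leqP => [le12|/ltnW le21]; apply: mord_eq;
  rewrite ?mem_msupp_monomial_diff ?eqxx ?orbT // => p;
  by rewrite mem_msupp_monomial_diff // => /orP[] /eqP->.
Qed.

Lemma initial_form_monomial_diff (u : 'X_{1..n} * 'X_{1..n}) : u.1 != u.2 ->
  initial_form (monomial_diff u) =
    if (mdeg u.1 < mdeg u.2)%N then 'X_[u.1]
    else if (mdeg u.2 < mdeg u.1)%N then - 'X_[u.2] else monomial_diff u.
Proof.
move=> u12; rewrite /initial_form mord_monomial_diff // pihomogB !pihomogX.
by case: ltngtP => e; rewrite ?(gtn_eqF e) ?(ltn_eqF e) ?eqxx ?subr0 ?sub0r // e eqxx.
Qed.

End InitialFormFacts.

(** * Exponent vectors in the four variables x, y, z, t *)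

Local Notation i0 := (@Ordinal 4 0 isT).
Local Notation i1 := (@Ordinal 4 1 isT).
Local Notation i2 := (@Ordinal 4 2 isT).
Local Notation i3 := (@Ordinal 4 3 isT).

Definition mon4 e a b c : 'X_{1..4} := [multinom tnth [tuple e; a; b; c] i | i < 4].

Lemma forall_ord4 (P : 'I_4 -> Prop) : P i0 -> P i1 -> P i2 -> P i3 ->
  forall i, P i.
Proof.
move=> P0 P1 P2 P3 [[|[|[|[|//]]]] lt_i].
- by rewrite (bool_irrelevance lt_i isT).
- by rewrite (bool_irrelevance lt_i isT).
- by rewrite (bool_irrelevance lt_i isT).
- by rewrite (bool_irrelevance lt_i isT).
Qed.

Lemma big_ord4 (R : Type) (idx : R) (op : Monoid.law idx) (F : 'I_4 -> R) :
  \big[op/idx]_(i < 4) F i = op (op (op (F i0) (F i1)) (F i2)) (F i3).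
Proof.
rewrite !big_ord_recl big_ord0 Monoid.mulm1 !Monoid.mulmA.
by congr (op (op (op (F _) (F _)) (F _)) (F _)); apply: val_inj.
Qed.

Lemma mon4_coords (m : 'X_{1..4}) : m = mon4 (m i0) (m i1) (m i2) (m i3).
Proof. by apply/mnmP; apply: forall_ord4; rewrite mnmE. Qed.

Lemma mon4P (P : 'X_{1..4} -> Prop) : (forall e a b c, P (mon4 e a b c)) ->
  forall m, P m.
Proof. by move=> Pmon m; rewrite [m]mon4_coords. Qed.

Lemma mon4_inj e a b c e' a' b' c' : mon4 e a b c = mon4 e' a' b' c' ->
  [/\ e = e', a = a', b = b' & c = c'].
Proof.
move=> /mnmP E; have := E i0; have := E i1; have := E i2; have := E i3.
by rewrite !mnmE.
Qed.

Lemma lem_mon4 e a b c e' a' b' c' :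
  (mon4 e a b c <= mon4 e' a' b' c')%MM =
  [&& e <= e', a <= a', b <= b' & c <= c']%N.
Proof.
apply/mnm_lepP/and4P => [le_m|[*]]; last first.
  by apply: (forall_ord4 (P := fun i => _ i <= _ i)%N); rewrite !mnmE.
by have := le_m i0; have := le_m i1; have := le_m i2; have := le_m i3; rewrite !mnmE.
Qed.

Lemma mdeg_mon4 e a b c : mdeg (mon4 e a b c) = (e + a + b + c)%N.
Proof. by rewrite mdegE big_ord4 !mnmE. Qed.

(** * Weights, and the generators as pairs of exponents *)

Section Curve.
Variables (K : fieldType) (h : nat).

Lemma mpolyX_mon4 e a b c : 'X_[mon4 e a b c] =
  varx K ^+ e * vary K ^+ a * varz K ^+ b * vart K ^+ c.
Proof. by rewrite mpolyXE_id big_ord4 !mnmE. Qed.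

Definition weight (m : 'X_{1..4}) : nat :=
  \sum_(i < 4) m i * tnth (curve_exponents h) i.

Lemma weight_mon4 e a b c : weight (mon4 e a b c) =
  (e * ((2 * h - 1) * (2 * h)) + a * ((2 * h - 1) * (2 * h + 1))
   + b * (2 * h * (2 * h + 1)) + c * (2 * h * (2 * h + 1) + 2 * h - 1))%N.
Proof. by rewrite /weight big_ord4 !mnmE. Qed.

Lemma weightD m m' : weight (m + m')%MM = (weight m + weight m')%N.
Proof.
by rewrite -big_split; apply: eq_bigr => i _; rewrite mnmDE mulnDl.
Qed.

Lemma curve_mapX m : curve_map h 'X_[m] = 'X^(weight m) :> {poly K}.
Proof.
rewrite /curve_map mmapX /mmap1 /weight (big_morph _ (exprD _) (expr0 _)).
by apply: eq_bigr => i _; rewrite -exprM mulnC.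
Qed.

Lemma curve_mapM (f g : {mpoly K[4]}) :
  curve_map h (f * g) = curve_map h f * curve_map h g.
Proof. exact: rmorphM. Qed.

Lemma curve_map_sum (T : Type) (r : seq T) (F : T -> {mpoly K[4]}) :
  curve_map h (\sum_(i <- r) F i) = \sum_(i <- r) curve_map h (F i).
Proof. exact: raddf_sum. Qed.

Lemma coef_curve_map (f : {mpoly K[4]}) w :
  (curve_map h f)`_w = \sum_(m <- msupp f | weight m == w) f@_m.
Proof.
rewrite {1}[f]mpolyE curve_map_sum coef_sum [RHS]big_mkcond /=.
apply: eq_bigr => m _; rewrite /curve_map mmapZ -/(curve_map h _) curve_mapX.
by rewrite coefCM coefXn eq_sym; case: eqP; rewrite ?mulr1 ?mulr0.
Qed.

(** Grouping the monomials by weight, the factor of [F w] is the coefficient of $s^w$ in the image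
    of [f], which is 0. Taking for [F w] a normal form of weight [w] makes the normal form of [f]
    vanish. *)
Lemma curve_ideal_sum0 (V : lmodType K) (F : nat -> V) (f : {mpoly K[4]}) :
  curve_ideal h f -> \sum_(m <- msupp f) f@_m *: F (weight m) = 0.
Proof.
move=> If; pose N := (\max_(m <- msupp f) weight m).+1.
transitivity (\sum_(w < N) (curve_map h f)`_w *: F w); last first.
  by rewrite big1 // => w _; rewrite If coef0 scale0r.
under [RHS]eq_bigr do rewrite coef_curve_map scaler_suml.
rewrite (exchange_big_dep xpredT) //= big_seq [RHS]big_seq.
apply: eq_bigr => m fm; have ltN : (weight m < N)%N.
  by rewrite ltnS; exact: (leq_bigmax_seq (F := weight)).
by rewrite (big_pred1 (Ordinal ltN)) // => w; rewrite -val_eqE /= eq_sym.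
Qed.

Definition exponent_pairs : seq ('X_{1..4} * 'X_{1..4}) :=
  [seq (mon4 0 0 (i - 1) (2 * h - i), mon4 (i + 1) (2 * h - i) 0 0)
     | i <- index_iota 1 (2 * h).+1]
  ++ [:: (mon4 1 0 0 1, mon4 0 1 1 0)]
  ++ [seq (mon4 (2 * h + 1 - j) 0 j 0, mon4 0 (2 * h - j) 0 j)
       | j <- index_iota 0 (2 * h - 2).+1].

Lemma curve_generatorsE :
  curve_generators K h = map (@monomial_diff 4 K) exponent_pairs.
Proof.
rewrite /curve_generators !map_cat -!map_comp.
congr (_ ++ _ ++ _); [apply: eq_map | congr [:: _] | apply: eq_map].
- by move=> i; rewrite /= /monomial_diff /= !mpolyX_mon4; ring.
- by rewrite /monomial_diff /= !mpolyX_mon4; ring.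
- by move=> i; rewrite /= /monomial_diff /= !mpolyX_mon4; ring.
Qed.

Variant exponent_pair_spec : 'X_{1..4} * 'X_{1..4} -> Prop :=
| PairA i of (1 <= i <= 2 * h)%N : exponent_pair_spec
    (mon4 0 0 (i - 1) (2 * h - i), mon4 (i + 1) (2 * h - i) 0 0)
| PairB : exponent_pair_spec (mon4 1 0 0 1, mon4 0 1 1 0)
| PairC j of (j <= 2 * h - 2)%N : exponent_pair_spec
    (mon4 (2 * h + 1 - j) 0 j 0, mon4 0 (2 * h - j) 0 j).

Lemma exponent_pairsP u : u \in exponent_pairs <-> exponent_pair_spec u.
Proof.
rewrite !mem_cat mem_seq1; split.
  case/or3P => [/mapP[i]|/eqP->|/mapP[j]].
  - by rewrite mem_index_iota ltnS => ? ->; constructor.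
  - by constructor.
  - by rewrite mem_index_iota ltnS => ? ->; constructor.
case=> [i hi||j hj].
- by apply/or3P/Or31/mapP; exists i; rewrite // mem_index_iota.
- by apply/or3P/Or32.
- by apply/or3P/Or33/mapP; exists j; rewrite // mem_index_iota.
Qed.

Hypothesis h_ge2 : (2 <= h)%N.

Lemma size_exponent_pairs : size exponent_pairs = (4 * h)%N.
Proof. rewrite !size_cat !size_map !size_iota /=; lia. Qed.

Lemma exponent_pairs_uniq : uniq exponent_pairs.
Proof.
rewrite cat_uniq cat_uniq; apply/and3P; split; last apply/and3P; last split=> //.
- rewrite map_inj_uniq ?iota_uniq // => i j /(congr1 snd) /mon4_inj[/eqP].
  by rewrite eqn_add2r => /eqP.
- apply/hasPn => u; rewrite mem_cat mem_seq1 => /orP[/eqP->|/mapP[j]].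
    by apply/negP => /mapP[i ir] /(congr1 fst) /mon4_inj[]; lia.
  rewrite mem_index_iota => jr ->.
  by apply/negP => /mapP[i ir] /(congr1 fst) /mon4_inj[]; lia.
- apply/hasPn => u /mapP[j + ->]; rewrite mem_index_iota mem_seq1 => jr.
  by apply/eqP => /(congr1 fst) /mon4_inj[]; lia.
- by rewrite map_inj_uniq ?iota_uniq // => i j /(congr1 fst) /mon4_inj[].
Qed.

Lemma exponent_pair_neq u : exponent_pair_spec u -> u.1 != u.2.
Proof. by case=> [i hi||j hj]; apply/eqP => /= /mon4_inj[]; lia. Qed.

Lemma weight_pair u : exponent_pair_spec u -> weight u.1 = weight u.2.
Proof.
case=> [i hi||j hj]; rewrite /= !weight_mon4.
(* In each family, $2h$ is written as a sum so that the truncated subtractions disappear and [ring]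
   applies. *)
- have [i' [k [-> E]]] : exists i' k, i = i'.+1 /\ (2 * h = i'.+1 + k)%N.
    by exists i.-1, (2 * h - i)%N; lia.
  rewrite E; have -> : (i'.+1 + k - 1 = i' + k)%N by lia.
  have -> : (i'.+1 - 1 = i')%N by lia.
  have -> : (i'.+1 + k - i'.+1 = k)%N by lia.
  have -> : ((i'.+1 + k) * (i'.+1 + k + 1) + (i'.+1 + k) - 1 =
    (i'.+1 + k) * (i'.+1 + k + 1) + (i' + k))%N by lia.
  ring.
- have [k E] : exists k, (2 * h = k.+1)%N by exists (2 * h).-1; lia.
  rewrite E; have -> : (k.+1 * (k.+1 + 1) + k.+1 - 1 = k.+1 * (k.+1 + 1) + k)%N by lia.
  rewrite subn1 /=; ring.
- have [k E] : exists k, (2 * h = j + k.+2)%N by exists (2 * h - j).-2; lia.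
  rewrite E; have -> : (j + k.+2 + 1 - j = k.+3)%N by lia.
  have -> : (j + k.+2 - 1 = j + k.+1)%N by lia.
  have -> : (j + k.+2 - j = k.+2)%N by lia.
  have -> : ((j + k.+2) * (j + k.+2 + 1) + (j + k.+2) - 1 =
    (j + k.+2) * (j + k.+2 + 1) + (j + k.+1))%N by lia.
  ring.
Qed.

(** * Lowest-degree monomials, and standard monomials recovered from their weights *)

(** The only tie is $xt-yz$, where this gives $xt$, although rewriting goes from $yz$ to $xt$. *)
Definition lead_exp (u : 'X_{1..4} * 'X_{1..4}) :=
  if (mdeg u.1 <= mdeg u.2)%N then u.1 else u.2.

(** The values of [lead_exp] are $z^{i-1}t^{2h-i}$, $xt$ and $y^{2h-j}t^j$. None is divisible by
    $yz$ or by $x^2$, which divides every higher-degree monomial. Within a family the degrees agree;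
    between families the variables differ, except that $t^{2h-1}$ fails to divide $y^{2h-j}t^j$
    because $j\le 2h-2$. *)
Lemma lead_exp_ndvd u v m : exponent_pair_spec u -> exponent_pair_spec v ->
  u != v -> (m == v.1) || (m == v.2) -> ~~ (m <= lead_exp u)%MM.
Proof.
rewrite /lead_exp.
case=> [i hi||j hj] [i' hi'||j' hj'] /= neq /orP[]/eqP->;
  rewrite !mdeg_mon4 ?leqnn; try case: leqP => ?; rewrite lem_mon4;
  apply/negP => /and4P[]; try lia.
- by move=> *; case/eqP: neq; have -> : i' = i by lia.
- by rewrite eqxx in neq.
- by move=> *; case/eqP: neq; have -> : j' = j by lia.
Qed.

(* The monomials outside the initial ideal, where xt represents the class of yz. *)
Definition standard (m : 'X_{1..4}) : bool :=
  if m i2 == 0%N then (m i1 + m i3 < 2 * h)%N && (m i3 <= 2 * h - 2)%N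
  else (m i1 == 0%N) && (m i2 + m i3 <= 2 * h - 2)%N.

(* The residues of the weight modulo 2h and 2h - 1 give y + t and z + t. *)
Definition normal_exp (w : nat) : 'X_{1..4} :=
  let u := (w * (2 * h - 1) %% (2 * h))%N in
  let v := (w * h %% (2 * h - 1))%N in
  let m e := if (v <= u)%N then mon4 e (u - v) 0 v else mon4 e 0 (v - u) u in
  m ((w - weight (m 0%N)) %/ ((2 * h - 1) * (2 * h)))%N.

(** In a standard monomial y or z is absent, so the smaller of the sums $a+c$ and $b+c$ is the
    exponent of t; the remaining weight gives that of x. *)
Lemma normal_exp_weight m : standard m -> normal_exp (weight m) = m.
Proof.
elim/mon4P: m => e a b c; rewrite /standard !mnmE.
rewrite /= !(tnth_nth 0%N) /= => std.
have [k E] : exists k, (2 * h = k.+2)%N by exists (2 * h).-2; lia.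
(* Modulo $2h$ the weights of x, y, z, t are 0, -1, 0, -1, and the factor $2h-1$ is -1; standardness
   gives $a+c<2h$. *)
have uE : (weight (mon4 e a b c) * (2 * h - 1) %% (2 * h) = a + c)%N.
  rewrite weight_mon4 E subn1 /=.
  have -> : (k.+2 * (k.+2 + 1) + k.+2 - 1 = k.+2 * (k.+2 + 1) + k.+1)%N by lia.
  rewrite (_ : (_ * k.+1 = (e * k.+1 * k.+1 + a * (k.+1 * k.+1 + k)
    + b * k.+1 * (k.+2 + 1) + c * ((k.+2 + 1) * k.+1 + k)) * k.+2 + (a + c))%N); last by ring.
  by rewrite modnMDl modn_small //; case: eqP std; lia.
(* Modulo $2h-1$ the weights are 0, 0, 2, 2, and $h$ is the inverse of 2; standardness gives
   $b+c<2h-1$. *)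
have vE : (weight (mon4 e a b c) * h %% (2 * h - 1) = b + c)%N.
  rewrite weight_mon4.
  have [k' hE] : exists k', h = k'.+1 by exists h.-1; lia.
  have -> : (2 * h * (2 * h + 1) + 2 * h - 1 = 2 * h * (2 * h + 1) + (2 * h - 1))%N by lia.
  rewrite hE; have -> : (2 * k'.+1 - 1 = 2 * k' + 1)%N by lia.
  rewrite (_ : (_ * k'.+1 = (e * (2 * k'.+1) * k'.+1 + a * (2 * k'.+1 + 1) * k'.+1
    + b * ((2 * k' + 1 + 3) * k'.+1 + 1)
    + c * ((2 * k' + 1 + 4) * k'.+1 + 1)) * (2 * k' + 1) + (b + c))%N); last by ring.
  by rewrite modnMDl modn_small //; case: eqP std; lia.
rewrite /normal_exp uE vE; have [b0|b_neq0] := eqVneq b 0%N.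
  have -> : (b + c <= a + c)%N by lia.
  rewrite b0 add0n addnK !weight_mon4 !mul0n !addn0 add0n -!addnA addnK.
  by rewrite mulnK // muln_gt0; lia.
have a0 : a = 0%N by case: eqP std; lia.
have -> : (b + c <= a + c)%N = false by lia.
rewrite a0 add0n addnK !weight_mon4 !mul0n !addn0 add0n -!addnA addnK.
by rewrite mulnK // muln_gt0; lia.
Qed.

End Curve.

(** * Rewriting modulo I and modulo the initial forms *)

Section Reduction.
Variables (K : fieldType) (h : nat).
Hypothesis h_ge2 : (2 <= h)%N.

Notation J := (ideal_gen (fun f => f \in curve_generators K h)).
Notation Jinit :=
  (ideal_gen (fun f => f \in map (@initial_form 4 K) (curve_generators K h))).

(** One relation tracks both ideals: [l] and [r] agree modulo [J], and either they agree modulo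
    [Jinit] in equal degree, or the degree rises and [l] itself lies in [Jinit]. Growth of the
    x-exponent is kept apart, so the relation is reflexive. *)
Definition reduces (l r : 'X_{1..4}) : Prop :=
  [/\ weight h l = weight h r,
      J ('X_[l] - 'X_[r])
    & mdeg l = mdeg r /\ Jinit ('X_[l] - 'X_[r]) \/
      (mdeg l < mdeg r)%N /\ Jinit 'X_[l]].

Lemma reduces_refl m : reduces m m.
Proof. by split=> //; [|left; split=> //]; rewrite subrr; exact: ideal_gen0. Qed.

Lemma reduces_trans p l r : reduces l p -> reduces p r -> reduces l r.
Proof.
move=> [wlp Jlp dlp] [wpr Jpr dpr].
have lrE : 'X_[l] - 'X_[r] = ('X_[l] - 'X_[p]) + ('X_[p] - 'X_[r]) :> {mpoly K[4]}.
  by rewrite addrA subrK.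
split; first by rewrite wlp.
  by rewrite lrE; apply: ideal_genD.
case: dlp dpr => [[-> Jlp']|[lt_lp Jl]] [[dpr Jpr']|[lt_pr Jp]].
- by left; split=> //; rewrite lrE; apply: ideal_genD.
- by right; split=> //; exact: ideal_gen_cancel Jlp' Jp.
- by right; split=> //; rewrite -dpr.
- by right; split=> //; exact: ltn_trans lt_pr.
Qed.

Lemma reducesD m l r : reduces l r -> reduces (l + m)%MM (r + m)%MM.
Proof.
move=> [w Jlr d]; rewrite /reduces !weightD w !mdegD !mpolyXD -mulrBl.
split=> //; first exact: ideal_genMr.
case: d => [[-> Jlr']|[lt_lr Jl]]; [left | right];
  by rewrite ?ltn_add2r; split=> //; apply: ideal_genMr.
Qed.

Lemma reduces_pair u : exponent_pair_spec h u ->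
  reduces (lead_exp u) (if lead_exp u == u.1 then u.2 else u.1).
Proof.
move=> u_spec; have w := weight_pair h_ge2 u_spec.
have neq := exponent_pair_neq h_ge2 u_spec.
have uJ : J (monomial_diff K u).
  apply: mem_ideal_gen; rewrite curve_generatorsE map_f //.
  exact/exponent_pairsP.
have uJinit : Jinit (initial_form (monomial_diff K u)).
  apply: mem_ideal_gen; rewrite curve_generatorsE map_f // map_f //.
  exact/exponent_pairsP.
move: uJinit; rewrite initial_form_monomial_diff // /lead_exp.
case: ltngtP => d; rewrite ?eqxx 1?eq_sym ?(negPf neq) => uJinit.
- by split=> //; right.
- split=> //; first by rewrite -opprB; exact: ideal_genN.
  by right; split=> //; rewrite -[X in Jinit X]opprK; exact: ideal_genN.
- by split=> //; left.
Qed.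

(** Both sides have degree 2, so the rule read off $xt-yz$ can be reversed by a change of sign. *)
Lemma reduces_yz : reduces (mon4 0 1 1 0) (mon4 1 0 0 1).
Proof.
have := reduces_pair (PairB h); rewrite /lead_exp !mdeg_mon4 /= eqxx.
move=> [w Jxy d]; split; first by rewrite w.
  by rewrite -opprB; exact: ideal_genN.
case: d => [[dd Jxy']|[]]; last by rewrite !mdeg_mon4.
by left; split; rewrite // -opprB; exact: ideal_genN.
Qed.

Lemma reduces_A i : (1 <= i <= 2 * h)%N ->
  reduces (mon4 0 0 (i - 1) (2 * h - i)) (mon4 (i + 1) (2 * h - i) 0 0).
Proof.
move=> hi; have := reduces_pair (PairA hi); rewrite /lead_exp !mdeg_mon4 /=.
by rewrite ifT ?eqxx //; lia.
Qed.

Lemma reduces_C j : (j <= 2 * h - 2)%N ->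
  reduces (mon4 0 (2 * h - j) 0 j) (mon4 (2 * h + 1 - j) 0 j 0).
Proof.
move=> hj; have := reduces_pair (PairC hj); rewrite /lead_exp !mdeg_mon4 /=.
rewrite ifF; last by lia.
by rewrite ifF //; apply/eqP => /mon4_inj[]; lia.
Qed.

(** Each way of violating [standard] exhibits a divisor to rewrite: $t^{2h-1}$ or $y^{2h-c}t^c$
    without z, $yz$ with both y and z, and some $z^{i-1}t^{2h-i}$ with z but not y. *)
Lemma standard_or_reduces m : standard h m \/
  exists l r, [/\ reduces l r, (l i0 < r i0)%N & (l <= m)%MM].
Proof.
elim/mon4P: m => e a b c; rewrite /standard !mnmE !(tnth_nth 0%N) /=.
have lift l r e1 a1 b1 c1 e2 a2 b2 c2 :
  l = mon4 e1 a1 b1 c1 -> r = mon4 e2 a2 b2 c2 -> reduces l r ->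
  (e1 < e2)%N -> [&& e1 <= e, a1 <= a, b1 <= b & c1 <= c]%N ->
  exists l r, [/\ reduces l r, (l i0 < r i0)%N & (l <= mon4 e a b c)%MM].
  move=> -> -> red lt_e le_m; exists (mon4 e1 a1 b1 c1), (mon4 e2 a2 b2 c2).
  by rewrite lem_mon4 !mnmE !(tnth_nth 0%N).
case: eqVneq => [b0|b_neq0].
  have [c_le|c_gt] := leqP c (2 * h - 2); last first.
    by right; apply: (lift _ _ _ _ _ _ _ _ _ _ erefl erefl (@reduces_A 1 _)); lia.
  have [|ac_ge] := ltnP (a + c) (2 * h); first by left.
  by right; apply: (lift _ _ _ _ _ _ _ _ _ _ erefl erefl (reduces_C c_le)); lia.
case: eqVneq => [a0|a_neq0]; last first.
  by right; apply: (lift _ _ _ _ _ _ _ _ _ _ erefl erefl reduces_yz); lia.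
have [|bc_gt] := leqP (b + c) (2 * h - 2); first by left.
(* Take as many factors z as possible, at most $2h-1$; the missing factors t are available since
   $b+c\ge 2h-1$. *)
right; pose i := (minn b (2 * h - 1)).+1.
by apply: (lift _ _ _ _ _ _ _ _ _ _ erefl erefl (@reduces_A i _)); lia.
Qed.

Lemma coord_le_weight (m : 'X_{1..4}) : (m i0 <= weight h m)%N.
Proof.
elim/mon4P: m => e a b c; rewrite weight_mon4 mnmE (tnth_nth 0%N) /= -!addnA.
apply: leq_trans (leq_addr _ _); rewrite leq_pmulr // muln_gt0; lia.
Qed.

(* Every rewriting step preserves the weight and increases the exponent of x,
   which the weight bounds; hence rewriting ends, at a standard monomial. *)
Lemma reduces_normal m : reduces m (normal_exp h (weight h m)).
Proof.
have [k] := ubnP (weight h m - m i0)%N; elim: k m => // k IH m lt_k.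
have [std|[l [r [red lt_x le_lm]]]] := standard_or_reduces m.
  by rewrite normal_exp_weight //; exact: reduces_refl.
pose m' := (r + (m - l))%MM.
have red' : reduces m m' by rewrite -{1}(submK le_lm) addmC; apply: reducesD.
case: (red') => wE _ _; rewrite wE; apply: (reduces_trans red').
apply: IH; rewrite -wE; have := coord_le_weight m'; rewrite -wE.
have /mnm_lepP/(_ i0) := le_lm; rewrite /m' mnmDE mnmBE; lia.
Qed.

(** Subtracting the vanishing normal form of [f] turns [f] into a combination of differences between
    monomials and their normal forms, all in [J]. *)
Lemma curve_ideal_gen f : curve_ideal h f -> J f.
Proof.
move=> If; rewrite -[f]subr0.
rewrite -(curve_ideal_sum0 (fun w => 'X_[normal_exp h w]) If) {1}[f]mpolyE.
rewrite -sumrB; apply: ideal_gen_sum => m _; rewrite -scalerBr -mul_mpolyC.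
by apply: ideal_genMl; case: (reduces_normal m).
Qed.

(* A monomial of higher degree never reaches a normal form of degree [mord f],
   so only the degree [mord f] parts contribute. *)
Lemma initial_form_gen f : curve_ideal h f -> Jinit (initial_form f).
Proof.
move=> If; rewrite -[initial_form f]subr0.
pose F w : {mpoly K[4]} := if mdeg (normal_exp h w) == mord f
  then 'X_[normal_exp h w] else 0.
rewrite -(curve_ideal_sum0 F If) /initial_form pihomogE big_mkcond -sumrB /=.
apply: ideal_gen_sum => m /mord_le fm; rewrite /F.
have [_ _] := reduces_normal m; case=> [[<- Jm]|[lt_m Jm]].
  case: eqP => _; last by rewrite scaler0 subrr; exact: ideal_gen0.
  by rewrite -scalerBr -mul_mpolyC; exact: ideal_genMl.
rewrite [mdeg (normal_exp _ _) == _]gtn_eqF ?(leq_ltn_trans fm) // scaler0 subr0.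
case: eqP => _; last exact: ideal_gen0.
by rewrite -mul_mpolyC; exact: ideal_genMl.
Qed.

(** * Generation of I and of its initial ideal, with the witnesses for minimality *)

Lemma curve_ideal_pair u : exponent_pair_spec h u ->
  curve_ideal h (monomial_diff K u).
Proof.
move=> u_spec; rewrite /curve_ideal /monomial_diff /curve_map mmapB.
by rewrite -!/(curve_map h _) !curve_mapX (weight_pair h_ge2 u_spec) subrr.
Qed.

Lemma curve_ideal_generators f : f \in curve_generators K h ->
  curve_ideal h f /\ f != 0.
Proof.
rewrite curve_generatorsE => /mapP[u /exponent_pairsP u_spec ->].
split; first exact: curve_ideal_pair.
have := mem_msupp_monomial_diff K u.1 (exponent_pair_neq h_ge2 u_spec).
by rewrite eqxx; apply: contraTneq => ->; rewrite msupp0.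
Qed.

Lemma curve_generators_generate :
  generates (curve_ideal h) (curve_generators K h).
Proof.
move=> f; split=> [|[s [s_gen ->]]]; first exact: curve_ideal_gen.
rewrite /curve_ideal curve_map_sum big_seq big1 // => u /s_gen.
move=> /curve_ideal_generators[Iu _]; rewrite curve_mapM.
by move: Iu; rewrite /curve_ideal => ->; rewrite mulr0.
Qed.

Lemma initial_ideal_generate :
  generates (initial_ideal (curve_ideal h))
    (map (@initial_form 4 K) (curve_generators K h)).
Proof.
move=> f; split; apply: ideal_gen_min => g.
  by case=> p [Ip _ ->]; exact: initial_form_gen.
move=> /mapP[p /curve_ideal_generators[Ip p0] ->].
by apply: mem_ideal_gen; exists p.
Qed.

Lemma msupp_initial_pair u m : exponent_pair_spec h u ->
  m \in msupp (initial_form (monomial_diff K u)) -> (m == u.1) || (m == u.2).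
Proof.
move=> /(exponent_pair_neq h_ge2) neq; rewrite initial_form_monomial_diff //.
case: ltngtP => _; last by rewrite mem_msupp_monomial_diff.
- by rewrite msuppX mem_seq1 => ->.
- by rewrite (perm_mem (msuppN _)) msuppX mem_seq1 orbC => ->.
Qed.

Lemma lead_exp_initial u : exponent_pair_spec h u ->
  lead_exp u \in msupp (initial_form (monomial_diff K u)).
Proof.
move=> /(exponent_pair_neq h_ge2) neq; rewrite initial_form_monomial_diff //.
rewrite /lead_exp; case: ltngtP => _.
- by rewrite msuppX mem_seq1.
- by rewrite (perm_mem (msuppN _)) msuppX mem_seq1.
- by rewrite mem_msupp_monomial_diff // eqxx.
Qed.

Lemma lead_exp_supp u : exponent_pair_spec h u ->
  lead_exp u \in msupp (monomial_diff K u).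
Proof.
move=> /(exponent_pair_neq h_ge2) neq; rewrite mem_msupp_monomial_diff //.
by rewrite /lead_exp; case: ifP; rewrite eqxx ?orbT.
Qed.

End Reduction.

Theorem mainTheorem7 (K : fieldType) (h : nat) (h_ge2 : (2 <= h)%N) :
  [/\ size (curve_generators K h) = (4 * h)%N,
      uniq (curve_generators K h),
      minimal_generating_set (@curve_ideal K h) (curve_generators K h)
    & minimal_standard_basis (@curve_ideal K h) (curve_generators K h)].
Proof.
have ndvd i k m : i \in exponent_pairs h -> k \in exponent_pairs h -> i != k ->
    m \in msupp (monomial_diff K k) -> ~~ (m <= lead_exp i)%MM.
  move=> /exponent_pairsP hi /exponent_pairsP hk neq.
  rewrite mem_msupp_monomial_diff ?(exponent_pair_neq h_ge2 hk) //.
  exact: (lead_exp_ndvd h_ge2 hi hk neq).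
have supp i : i \in exponent_pairs h -> lead_exp i \in msupp (monomial_diff K i).
  by move=> /exponent_pairsP; exact: lead_exp_supp.
have pairs_uniq := exponent_pairs_uniq h_ge2.
split.
- by rewrite curve_generatorsE size_map size_exponent_pairs.
- by rewrite curve_generatorsE (witness_uniq pairs_uniq supp ndvd).
- have := @curve_generators_generate K h h_ge2; rewrite curve_generatorsE.
  exact: witness_minimal pairs_uniq supp ndvd _.
- have gen := @initial_ideal_generate K h h_ge2.
  split; first by split=> // f; exact: curve_ideal_generators.
  move: gen; rewrite curve_generatorsE -map_comp.
  (* The same witnesses serve, since an initial form keeps the lowest-degree monomial and adds no
     new one. *)
  apply: (witness_minimal (M := @lead_exp) pairs_uniq).
    by move=> i /exponent_pairsP; exact: lead_exp_initial.
  move=> i k m /exponent_pairsP hi /exponent_pairsP hk neq.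
  move=> /(msupp_initial_pair h_ge2 hk); exact: (lead_exp_ndvd h_ge2 hi hk neq).
Qed.
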